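(* Let $n\geq 2$, $\Lambda\geq\lambda>0$, and let $u:\overline{\mathbb{R}^n_+}\to[0,+\infty]$ be a lower semicontinuous function satisfying, in the viscosity sense, $$u\geq 0,\qquad \mathcal{M}^-_{\lambda,\Lambda}(D^2u)\leq 0\quad\text{in } \mathbb{R}^n_+ .$$ For $r>0$ let $$\mu(r)=\inf_{x\in\mathcal{B}_r}\frac{u(x)}{x_n}.$$ Then $\mu(r)$ is a concave function of $r^{-\frac{\Lambda}{\lambda}n}$, i.e. for every fixed $R>r>0$ and for all $r\leq\rho\leq R$ one has $$\mu(\rho)\geq\frac{\mu(r)\left(\rho^{-\frac{\Lambda}{\lambda}n}-R^{-\frac{\Lambda}{\lambda}n}\right)+\mu(R)\left(r^{-\frac{\Lambda}{\lambda}n}-\rho^{-\frac{\Lambda}{\lambda}n}\right)}{r^{-\frac{\Lambda}{\lambda}n}-R^{-\frac{\Lambda}{\lambda}n}} .$$ Consequently, the map $$r\in(0,+\infty)\mapsto\mu(r)\,r^{\frac{\Lambda}{\lambda}n}$$ is nondecreasing.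
   Context: $\mathbb{R}^n_+=\{x=(x',x_n)\in\mathbb{R}^{n-1}\times\mathbb{R} : x_n>0\}$. For a real symmetric $n\times n$ matrix $M$ with eigenvalues $\mu_1,\dots,\mu_n$, the Pucci inf-operator is $\mathcal{M}^-_{\lambda,\Lambda}(M)=\lambda\sum_{\mu_i>0}\mu_i+\Lambda\sum_{\mu_i<0}\mu_i$ (equivalently, the infimum of $\operatorname{tr}(AM)$ over symmetric $A$ with all eigenvalues in $[\lambda,\Lambda]$). For $x\in\mathbb{R}^n_+$ set $$d(x)=\left(\frac{|x|}{x_n}\right)^k|x|,\qquad k=\frac{\Lambda-\lambda}{\Lambda\,n},$$ and for $r>0$ let $\mathcal{B}_r=\{x\in\mathbb{R}^n_+ : d(x)<r\}$. The inequality $\mathcal{M}^-_{\lambda,\Lambda}(D^2u)\leq0$ holds in the viscosity sense in $\mathbb{R}^n_+$ if, whenever $x_0\in\mathbb{R}^n_+$ with $u(x_0)<+\infty$ and $\varphi$ is a $C^2$ function near $x_0$ such that $u-\varphi$ has a local minimum at $x_0$, one has $\mathcal{M}^-_{\lambda,\Lambda}(D^2\varphi(x_0))\leq0$. If $\mu$ takes the value $+\infty$, the inequalities are understood in $[0,+\infty]$ with $0\cdot\infty=0$. *)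

(* Defs.v *)
From HB Require Import structures.
From mathcomp Require Import all_boot all_order all_algebra.
From mathcomp Require Import complex.
From mathcomp Require Import all_classical all_reals all_analysis.
Set Implicit Arguments.
Unset Strict Implicit.
Unset Printing Implicit Defensive.
Import Order.TTheory GRing.Theory Num.Theory.
Import numFieldNormedType.Exports.
Local Open Scope classical_set_scope.
Local Open Scope ring_scope.

(* Points of R^n are row vectors in 'rV[R]_n.+1: the ambient dimension, written
   n in the mathematics, is n.+1 throughout, and x_n is the last coordinate. *)

Definition last_coord (R : realType) (n : nat) (x : 'rV[R]_n.+1) : R :=
  x ord0 ord_max.

(* The norm `|x| of the library on matrices is the sup norm. *)
Definition enorm (R : realType) (n : nat) (x : 'rV[R]_n) : R :=
  Num.sqrt (\sum_(i < n) x ord0 i ^+ 2).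

Definition half_space (R : realType) (n : nat) : set 'rV[R]_n.+1 :=
  [set x | 0 < last_coord x].
Arguments half_space : clear implicits.

(* Eigenvalues listed with multiplicity; meaningful when the characteristic
   polynomial splits over R, in particular for symmetric M (eigvalsP below). *)
Definition eigvals (R : realType) (n : nat) (M : 'M[R]_n) : seq R :=
  xget [::] [set s : seq R | char_poly M = \prod_(a <- s) ('X - a%:P)].

Definition pucci_inf (R : realType) (n : nat) (lam Lam : R) (M : 'M[R]_n) : R :=
  lam * (\sum_(a <- eigvals M | 0 < a) a)
  + Lam * (\sum_(a <- eigvals M | a < 0) a).

Definition partial (R : realType) (n : nat) (i : 'I_n.+1)
    (f : 'rV[R]_n.+1 -> R) : 'rV[R]_n.+1 -> R :=
  fun x => 'D_('e_i : 'rV[R]_n.+1) f x.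

Definition C2_near (R : realType) (n : nat) (f : 'rV[R]_n.+1 -> R)
    (x0 : 'rV[R]_n.+1) : Prop :=
  \forall x \near x0,
    [/\ {for x, continuous f},
        forall i, derivable f x 'e_i /\ {for x, continuous (partial i f)} &
        forall i j, derivable (partial i f) x 'e_j /\
                    {for x, continuous (partial j (partial i f))}].

Definition hessian (R : realType) (n : nat) (f : 'rV[R]_n.+1 -> R)
    (x0 : 'rV[R]_n.+1) : 'M[R]_n.+1 :=
  \matrix_(i, j) partial j (partial i f) x0.

(* M^-(D^2 u) <= 0 in the viscosity sense in the open half-space; only the
   values of u in the half-space matter. *)
Definition viscosity_supersolution (R : realType) (n : nat) (lam Lam : R)
    (u : 'rV[R]_n.+1 -> \bar R) : Prop :=
  forall (x0 : 'rV[R]_n.+1) (phi : 'rV[R]_n.+1 -> R),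
    half_space R n x0 -> (u x0 < +oo)%E -> C2_near phi x0 ->
    (\forall x \near x0, (u x0 - (phi x0)%:E <= u x - (phi x)%:E)%E) ->
    pucci_inf lam Lam (hessian phi x0) <= 0.

Definition dfun (R : realType) (n : nat) (lam Lam : R) (x : 'rV[R]_n.+1) : R :=
  ((enorm x / last_coord x) `^ ((Lam - lam) / (Lam * n.+1%:R))) * enorm x.

Definition dball (R : realType) (n : nat) (lam Lam r : R) : set 'rV[R]_n.+1 :=
  [set x | half_space R n x /\ dfun lam Lam x < r].

Definition mu (R : realType) (n : nat) (lam Lam : R)
    (u : 'rV[R]_n.+1 -> \bar R) (r : R) : \bar R :=
  ereal_inf [set (u x / (last_coord x)%:E)%E | x in dball lam Lam r].

Definition alpha (R : realType) (n : nat) (lam Lam : R) : R :=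
  Lam / lam * n.+1%:R.

Lemma eigvalsP (R : realType) (n : nat) (M : 'M[R]_n) : M^T = M ->
  char_poly M = \prod_(a <- eigvals M) ('X - a%:P).
Proof.
move=> Ms.
suff [s hs] : exists s : seq R, char_poly M = \prod_(a <- s) ('X - a%:P).
  by rewrite /eigvals; case: xgetP => [s0 _ //|/(_ s)]; case; exact: hs.
pose C : numClosedFieldType := complex.complex R.
pose f : {rmorphism R -> C} := complex.real_complex_def (Phant R).
have fI : injective f by exact: fmorph_inj.
pose A : 'M[C]_n := map_mx f M.
have Areal : A \is a realmx.
  by apply/mxOverP => i j; rewrite mxE; apply/complex.complex_realP; exists (M i j).
have Asym : A \is symmetricmx.
  by apply/is_hermitianmxP; rewrite expr0 scale1r map_mx_id // /A map_trmx Ms.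
have Aherm := realsym_hermsym Asym Areal.
have AE := orthomx_spectralP (hermitian_normalmx Aherm).
have Dreal := hermitian_spectral_diag_real Aherm.
set P := spectralmx A in AE; set D := spectral_diag A in AE Dreal.
have Pu : P \in unitmx by exact: spectral_unit.
pose d i : R := complex.Re (D ord0 i).
have dE i : f (d i) = D ord0 i.
  by rewrite /d /f /=; apply: complex.RRe_real; exact: (mxOverP Dreal).
exists [seq d i | i <- enum 'I_n].
apply: (map_poly_inj f); rewrite map_char_poly -/A.
have -> : char_poly A = char_poly (diag_mx D).
  rewrite /char_poly /char_poly_mx AE !map_mxM.
  have PX : map_mx (@polyC C) (invmx P) *m map_mx (@polyC C) P = 1%:M.
    by rewrite -map_mxM mulVmx // map_mx1.
  have XE : ('X%:M : 'M[{poly C}]_n)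
      = map_mx (@polyC C) (invmx P) *m 'X%:M *m map_mx (@polyC C) P.
    by rewrite mul_mx_scalar -scalemxAl PX scalemx1.
  by rewrite [in LHS]XE -mulmxBl -mulmxBr !det_mulmx mulrAC -det_mulmx
     PX det1 mul1r.
rewrite char_poly_trig ?diag_mx_is_trig // big_map big_enum rmorph_prod.
apply: eq_bigr => i _.
by rewrite rmorphB /= map_polyX map_polyC /= dE mxE eqxx mulr1n.
Qed.

(* Main.v *)
Require Import Defs.
From HB Require Import structures.
From mathcomp Require Import all_boot all_order all_algebra.
From mathcomp Require Import ring lra.
From mathcomp Require Import all_classical all_reals all_analysis.
Set Implicit Arguments.
Unset Strict Implicit.
Unset Printing Implicit Defensive.
Import Order.TTheory GRing.Theory Num.Theory.
Import numFieldNormedType.Exports.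
Local Open Scope classical_set_scope.
Local Open Scope ring_scope.

(* Put b = Lam / lam, let N be the dimension and g = b (N + 1) - 1.  Then
   q(x) = d(x)^(-alpha) = x_n^(b-1) |x|^(-g), and x_n q(x) is a classical
   subsolution: its Hessian is a rank-two perturbation of a multiple of the
   identity, whose spectrum is explicit.  Hence psi = x_n (A q + B) + e |x|^2 is a
   strict subsolution for A >= 0, e > 0.  Choosing A, B so that A q + B equals
   mu(r) where d = r and mu(Rad) where d = Rad, a negative minimum of u - psi
   over r <= d <= Rad could only be attained at an interior point, where it is
   excluded by the viscosity inequality; so u >= x_n (A q + B) there, that is,
   mu is concave in r^(-alpha).  Letting Rad tend to
   infinity and using mu >= 0 gives the monotonicity. *)

(** * Spectrum and Pucci operator of the barrier's Hessian *)

(* Sylvester's identity: eliminate in the block matrix [z, U; V, 1] either by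
   rows or by columns. *)
Lemma det_scalar_sub_mulmxC (K : comNzRingType) (m p : nat) (z : K)
    (U : 'M[K]_(m, p)) (V : 'M[K]_(p, m)) :
  z ^+ p * \det (z%:M - U *m V) = z ^+ m * \det (z%:M - V *m U).
Proof.
pose M := block_mx z%:M U V 1%:M.
have detl : \det M = \det (z%:M - U *m V).
  have : \det (block_mx 1%:M (- U) 0 1%:M *m M) = \det (z%:M - U *m V).
    rewrite mulmx_block !mul1mx !mul0mx !add0r mulmx1 subrr mulNmx.
    by rewrite det_lblock det1 mulr1.
  by rewrite det_mulmx det_ublock !det1 !mul1r.
have : \det (M *m block_mx 1%:M (- U) 0 z%:M) = z ^+ m * \det (z%:M - V *m U).
  rewrite mulmx_block !mulmx1 !mulmx0 !addr0 mul1mx mul_scalar_mx mul_mx_scalar.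
  by rewrite scalerN addNr mulmxN [- _ + _]addrC det_lblock det_scalar.
by rewrite det_mulmx det_ublock det1 mul1r det_scalar detl mulrC.
Qed.

Lemma det_2x2 (K : comNzRingType) (M : 'M[K]_2) :
  \det M = M ord0 ord0 * M ord_max ord_max - M ord0 ord_max * M ord_max ord0.
Proof.
rewrite (expand_det_row _ ord0) !big_ord_recl big_ord0 addr0 /cofactor !det_mx11.
rewrite !mxE /= expr0 expr1 mul1r mulN1r mulrN.
by congr (_ * _ - _ * _); congr (M _ _); apply: val_inj.
Qed.

Lemma det_scalar_sub_map_2x2 (K : comNzRingType) (W : 'M[K]_2) (a b : K)
    (z : {poly K}) :
  \tr W = a + b -> \det W = a * b ->
  \det (z%:M - map_mx (@polyC K) W) = (z - a%:P) * (z - b%:P).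
Proof.
rewrite /mxtrace !big_ord_recl big_ord0 addr0 !det_2x2.
have -> : lift ord0 ord0 = ord_max :> 'I_2 by apply: val_inj.
move=> trE detE; rewrite !mxE /= mulr0n mulr1n !sub0r.
have /(congr1 (@polyC K)) := trE; have /(congr1 (@polyC K)) := detE.
rewrite !polyCB !polyCD !polyCM.
set p := _%:P; set q := _%:P; set r := _%:P; set s := _%:P => det' tr'.
transitivity (z ^+ 2 - z * (p + q) + (p * q - r * s)); first by ring.
by rewrite tr' det'; ring.
Qed.

(** Sylvester's identity at [z = 'X - c] reduces the computation to the 2 x 2 matrix [V *m U]; the
    factor [z ^+ 2] is nonzero and can be cancelled. *)
Lemma char_poly_scalar_add_rank2 (K : fieldType) (n : nat) (c a b : K)
    (U : 'M[K]_(n.+1, 2)) (V : 'M[K]_(2, n.+1)) (n_gt0 : (0 < n)%N) :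
  \tr (V *m U) = a + b -> \det (V *m U) = a * b ->
  char_poly (c%:M + U *m V) =
    \prod_(z <- [:: c + a, c + b & nseq n.-1 c]) ('X - z%:P).
Proof.
move=> trE detE; set W := V *m U in trE detE.
pose Uc := map_mx (@polyC K) U; pose Vc := map_mx (@polyC K) V.
pose z : {poly K} := 'X - c%:P.
have zn0 : z != 0 by by rewrite polyXsubC_eq0.
have -> : char_poly (c%:M + U *m V) = \det (z%:M - Uc *m Vc).
  rewrite /char_poly /char_poly_mx map_mxD map_mxM map_scalar_mx opprD addrA.
  by rewrite -raddfB.
have := det_scalar_sub_mulmxC z Uc Vc.
have -> : \det (z%:M - Vc *m Uc) = ('X - (c + a)%:P) * ('X - (c + b)%:P).
  by rewrite -map_mxM (det_scalar_sub_map_2x2 _ trE detE) /z !polyCD; ring.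
move=> H; apply: (mulfI (expf_neq0 2 zn0)); rewrite H.
rewrite !big_cons big_nseq -/z.
have -> : iter n.-1 ( *%R z) 1 = z ^+ n.-1 by rewrite -Monoid.iteropE.
by rewrite -{1}(prednK n_gt0) !exprS; ring.
Qed.

(** [eigvals] is an arbitrary choice of root list, so only its multiset is determined, by unique
    factorization. *)
Lemma eigvals_perm_eq (R : realType) (n : nat) (M : 'M[R]_n) (s : seq R) :
  char_poly M = \prod_(a <- s) ('X - a%:P) -> perm_eq (eigvals M) s.
Proof.
move=> ME; apply: prod_XsubC_eq; rewrite -ME /eigvals.
by case: xgetP => [s0 _ /= ->//|/(_ s)[]].
Qed.

Lemma pucci_inf_sum (R : realType) (n : nat) (lam Lam : R) (M : 'M[R]_n)
    (s : seq R) :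
  char_poly M = \prod_(a <- s) ('X - a%:P) ->
  pucci_inf lam Lam M =
    \sum_(a <- s) (if 0 <= a then lam * a else Lam * a).
Proof.
move=> /eigvals_perm_eq ps; rewrite /pucci_inf !(perm_big _ ps)/=.
rewrite !mulr_sumr (big_mkcond (fun a => 0 < a)) (big_mkcond (fun a => a < 0)).
rewrite -big_split; apply: eq_bigr => a _ /=.
by case: (ltgtP 0 a) => [_|_|<-]; rewrite ?addr0 ?add0r ?mulr0.
Qed.

(* The roots a1, a2 belong to the rank-two part of the normalized Hessian of
   x_n^b |x|^(-g), whose remaining part is - g * identity; nu = N - 2 counts the
   eigenvalues - g, and w = |x|^2 / x_n^2.  The last inequality says that this
   Hessian has nonnegative Pucci operator. *)
Lemma barrier_spectrum (R : realType) (b nu w : R) :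
  1 <= b -> 0 <= nu -> 1 <= w ->
  let g := b * (nu + 3) - 1 in
  exists a1 a2 : R,
    [/\ a1 + a2 = b * (b - 1) * w - 2 * b * g + g * (g + 2),
        a1 * a2 = b * g * (2 * b - g - 2) * (w - 1),
        g <= a1, a2 <= g &
        b * (g - a2 + nu * g) <= a1 - g].
Proof.
move=> b1 nu0 w1 g.
pose T := b * (b - 1) * w - 2 * b * g + g * (g + 2).
pose D := b * g * (2 * b - g - 2) * (w - 1).
have bnu : nu <= b * nu by rewrite ler_peMl.
have gb : 3 * b - 1 + b * nu = g by rewrite /g; ring.
have g0 : 0 < g by lra.
have D0 : D <= 0.
  rewrite /D mulr_le0_ge0 //; last by lra.
  by rewrite mulr_ge0_le0 ?mulr_ge0 //; lra.
have disc : 0 <= T ^+ 2 - 4 * D by have := sqr_ge0 T; lra.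
pose s := Num.sqrt (T ^+ 2 - 4 * D).
have s0 : 0 <= s by exact: sqrtr_ge0.
have ss : s ^+ 2 = T ^+ 2 - 4 * D by rewrite sqr_sqrtr.
(* [p] and [q] are the signed distances from [g] to the two roots. Their product is minus the value
   of the quadratic at [g]; it is positive and [p + q = s >= 0], so [g] lies between the roots. *)
pose p := (T + s) / 2 - g; pose q := g - (T - s) / 2.
have pqT : p - q = T - 2 * g by rewrite /p /q; field.
have pqD : p * q = g * (b * (nu + 2)) * (b * (w - 1) + b * (nu + 2) - 1).
  transitivity (s ^+ 2 / 4 - T ^+ 2 / 4 + g * T - g ^+ 2).
    by rewrite /p /q; field.
  by rewrite ss /D /T /g; field.
have pqs : p + q = s by rewrite /p /q; field.
have bw : 0 <= b * (w - 1) by rewrite mulr_ge0 //; lra.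
have pq0 : 0 < p * q.
  rewrite pqD !mulr_gt0 //; first by lra.
  - by lra.
  - have : b * (nu + 2) = b * nu + 2 * b by ring.
    by lra.
have p0 : 0 < p by nra.
have q0 : 0 < q by nra.
exists (p + g), (g - q); split.
- by rewrite /p /q -/T; field.
- rewrite /p /q -/D; transitivity ((T ^+ 2 - s ^+ 2) / 4); first by field.
  by rewrite ss; field.
- by rewrite lerDr ltW.
- by rewrite gerBl ltW.
rewrite addrK opprB addrCA subrr addr0.
pose v := b * (w - 1) + b * (nu + 2) - 1.
pose qs := v + 2 * b.
(* qs is the value of q for which the claimed inequality is an equality; since
   q is the positive root of y^2 + (p - q) y - p q, q <= qs follows from E2. *)
have E1 : p - b * (q + nu * g) = (b - 1) * (qs - q).
  have -> : p = q + (T - 2 * g) by lra.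
  by rewrite /T /qs /v /g; ring.
have v0 : 0 <= v by rewrite /v; have : b * (nu + 2) = b * nu + 2 * b by [ring]; lra.
have E2 : (qs - q) * (qs + p) =
      b * ((v + 2 * b - g) ^+ 2 + g * (b * (nu + 1) + 1)).
  have -> : (qs - q) * (qs + p) = qs * (qs + (p - q)) - p * q by ring.
  by rewrite pqT pqD /T /qs /v /g; ring.
have qsq : 0 <= qs - q.
  have : 0 <= (qs - q) * (qs + p).
    rewrite E2 mulr_ge0 //; first by lra.
    rewrite addr_ge0 ?sqr_ge0 // mulr_ge0 ?(ltW g0) // addr_ge0 // mulr_ge0; lra.
  by rewrite pmulr_lge0 // /qs; lra.
by rewrite -subr_ge0 E1 mulr_ge0 // subr_ge0.
Qed.

Definition sqnorm (R : realType) (n : nat) (x : 'rV[R]_n) : R :=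
  \sum_(i < n) x ord0 i ^+ 2.

Lemma last_coord_sqr_le (R : realType) (n : nat) (x : 'rV[R]_n.+1) :
  last_coord x ^+ 2 <= sqnorm x.
Proof.
rewrite /sqnorm (bigD1 ord_max) //= lerDl.
by apply: sumr_ge0 => i _; exact: sqr_ge0.
Qed.

(* The Hessian of [barrier] below, with k = A x_n^b |x|^(-g) / |x|^2. *)
Definition barrier_hess (R : realType) (n : nat) (b g k e : R)
    (x : 'rV[R]_n.+1) : 'M[R]_n.+1 :=
  let t := last_coord x in let S := sqnorm x in
  \matrix_(i, j)
    (k * (b * (b - 1) * (S / t ^+ 2) * ((i == ord_max)%:R * (j == ord_max)%:R)
          - b * g / t * ((i == ord_max)%:R * x ord0 j
                         + x ord0 i * (j == ord_max)%:R)
          + g * (g + 2) / S * (x ord0 i * x ord0 j) - g * (i == j)%:R)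
     + e * (i == j)%:R).

(** The matrix is (e - k g) I plus a rank-two part with eigenvalues k a1 and k a2. The [k]-terms
    contribute a nonnegative amount by the last inequality of [barrier_spectrum], the [e]-terms at
    least (n + 1) lam e. *)
Lemma pucci_inf_barrier_hess_gt0 (R : realType) (n : nat)
    (lam Lam b k e : R) (x : 'rV[R]_n.+1) :
  (0 < n)%N -> 0 < lam -> 1 <= b -> Lam = b * lam -> 0 <= k -> 0 < e -> 0 < last_coord x ->
  0 < pucci_inf lam Lam (barrier_hess b (b * (n%:R + 2) - 1) k e x).
Proof.
move=> n0 l0 b1 LE k0 e0 t0; set g := b * (n%:R + 2) - 1.
set t := last_coord x in t0; pose S := sqnorm x.
have lL : lam <= Lam by rewrite LE ler_peMl // ltW.
have tS : t ^+ 2 <= S by exact: last_coord_sqr_le.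
have t20 : 0 < t ^+ 2 by rewrite exprn_gt0.
have S0 : 0 < S by exact: lt_le_trans tS.
have w1 : 1 <= S / t ^+ 2 by rewrite ler_pdivlMr // mul1r.
pose nu : R := n.-1%:R.
have nuE : n%:R = nu + 1 :> R by rewrite -[in LHS](prednK n0) -natr1.
have nu0 : 0 <= nu by exact: ler0n.
have gE : g = b * (nu + 3) - 1 by rewrite /g nuE; ring.
have := @barrier_spectrum R b nu _ b1 nu0 w1; rewrite /= -gE.
move=> [a1 [a2 [trE detE ga1 a2g ineq]]].
(* The columns of [U] are the last basis vector and x, and [V] is k G U^T for the symmetric 2 x 2
   matrix G with entries [g11], [g12], [g22]. *)
pose U : 'M[R]_(n.+1, 2) :=
  \matrix_(i, j) if j == ord0 then (i == ord_max)%:R else x ord0 i.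
pose g11 := b * (b - 1) * (S / t ^+ 2); pose g12 := - (b * g / t).
pose g22 := g * (g + 2) / S.
pose V : 'M[R]_(2, n.+1) := \matrix_(i, j)
  if i == ord0 then k * (g11 * (j == ord_max)%:R + g12 * x ord0 j)
  else k * (g12 * (j == ord_max)%:R + g22 * x ord0 j).
have sumd (c d : R) (f : 'I_n.+1 -> R) :
    \sum_j k * (c * (j == ord_max)%:R + d * x ord0 j) * f j =
    k * (c * f ord_max + d * \sum_j x ord0 j * f j).
  under eq_bigr do rewrite -mulrA mulrDl.
  rewrite -mulr_sumr big_split /=; congr (_ * (_ + _)).
    rewrite (bigD1 ord_max) //= eqxx mulr1 big1 ?addr0 // => j /negPf ->.
    by rewrite mulr0 mul0r.
  by rewrite mulr_sumr; apply: eq_bigr => j _; rewrite mulrA.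
have sumt : \sum_j x ord0 j * (j == ord_max)%:R = t.
  rewrite (bigD1 ord_max) //= eqxx mulr1 big1 ?addr0 // => j /negPf ->.
  by rewrite mulr0.
have sumS : \sum_j x ord0 j * x ord0 j = S by apply: eq_bigr => j _; rewrite expr2.
have VU00 : (V *m U) ord0 ord0 = k * (g11 + g12 * t).
  rewrite mxE; under eq_bigr do rewrite !mxE /=.
  by rewrite sumd sumt eqxx mulr1.
have VU01 : (V *m U) ord0 ord_max = k * (g11 * t + g12 * S).
  rewrite mxE; under eq_bigr do rewrite !mxE /=.
  by rewrite sumd sumS.
have VU10 : (V *m U) ord_max ord0 = k * (g12 + g22 * t).
  rewrite mxE; under eq_bigr do rewrite !mxE /=.
  by rewrite sumd sumt eqxx mulr1.
have VU11 : (V *m U) ord_max ord_max = k * (g12 * t + g22 * S).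
  rewrite mxE; under eq_bigr do rewrite !mxE /=.
  by rewrite sumd sumS.
have t0' := lt0r_neq0 t0; have S0' := lt0r_neq0 S0.
have trVU : \tr (V *m U) = k * a1 + k * a2.
  rewrite /mxtrace !big_ord_recl big_ord0 addr0.
  have -> : lift ord0 ord0 = ord_max :> 'I_2 by apply: val_inj.
  rewrite VU00 VU11 -!mulrDr trE /g11 /g12 /g22; congr (k * _).
  by field; rewrite t0' S0'.
have detVU : \det (V *m U) = (k * a1) * (k * a2).
  rewrite det_2x2 VU00 VU01 VU10 VU11.
  transitivity (k ^+ 2 * (a1 * a2)); last by ring.
  by rewrite detE /g11 /g12 /g22; field; rewrite t0' S0'.
have HE : barrier_hess b g k e x = (e - k * g)%:M + U *m V.
  apply/matrixP => i j; rewrite !mxE /=; under eq_bigr do rewrite !mxE /=.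
  rewrite !big_ord_recl big_ord0 addr0 /= -/t -/S -mulr_natr /g11 /g12 /g22.
  ring.
rewrite HE (pucci_inf_sum _ _ (char_poly_scalar_add_rank2 _ n0 trVU detVU)).
rewrite !big_cons big_nseq.
(* The eigenvalue weight t -> min(lam t, Lam t) is concave and positively homogeneous, hence
   superadditive: the shift [e] splits off. *)
have fp z : 0 <= z -> lam * (e + z) <= (if 0 <= e + z then lam * (e + z) else Lam * (e + z)).
  by move=> z0; rewrite ifT //; lra.
have fn z : z <= 0 -> lam * e + Lam * z <= (if 0 <= e + z then lam * (e + z) else Lam * (e + z)).
  by move=> z0; case: ifPn => [_|]; rewrite -?ltNge mulrDr; nra.
have itE c : iter n.-1 (+%R c) 0 = nu * c.
  by rewrite iter_addr_0 mulr_natl.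
rewrite itE.
have k1 : 0 <= k * (a1 - g) by rewrite mulr_ge0 // subr_ge0.
have k2 : k * (a2 - g) <= 0 by rewrite mulr_ge0_le0 // subr_le0.
have k3 : - (k * g) <= 0.
  rewrite oppr_le0 mulr_ge0 // gE.
  have : b * (nu + 3) = b * nu + 3 * b by ring.
  have : 0 <= b * nu by rewrite mulr_ge0 //; lra.
  lra.
have := fp _ k1; have := fn _ k2; have := fn _ k3.
have -> : e - k * g + k * a1 = e + k * (a1 - g) by ring.
have -> : e - k * g + k * a2 = e + k * (a2 - g) by ring.
set f1 := (if _ then _ else _); set f2 := (if _ then _ else _).
set f3 := (if _ then _ else _) => h1 h2 h3.
have h1' : nu * (lam * e + Lam * - (k * g)) <= nu * f1 by rewrite ler_wpM2l.
have : 0 <= lam * k * ((a1 - g) - b * (g - a2 + nu * g)).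
  by rewrite mulr_ge0 ?mulr_ge0 ?(ltW l0) // subr_ge0.
have : 0 < lam * e by rewrite mulr_gt0.
have : 0 <= nu * (lam * e) by rewrite !mulr_ge0 // ltW.
move: h1' h2 h3; rewrite LE.
lra.
Qed.

(** * Derivatives of the barrier *)

Section PointwiseDerivatives.
Context {R : realType} {n : nat}.
Implicit Types (f g : 'rV[R]_n -> R) (x v : 'rV[R]_n).

(** The differentiation rules are restated for functions written pointwise, so that they unify with
    explicit formulas such as that of [barrier]. *)
Lemma differentiable_cstf (c : R) x : differentiable (fun=> c : R) x.
Proof. exact: differentiable_cst. Qed.

Lemma differentiable_addf f g x : differentiable f x -> differentiable g x ->
  differentiable (fun y => f y + g y) x.
Proof. exact: differentiableD. Qed.

Lemma differentiable_mulf f g x : differentiable f x -> differentiable g x ->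
  differentiable (fun y => f y * g y) x.
Proof. exact: differentiableM. Qed.

Lemma differentiable_powRf f (a : R) x : 0 < f x -> differentiable f x ->
  differentiable (fun y => f y `^ a) x.
Proof.
move=> fx0 df; apply: (@differentiable_comp _ _ _ _ f ((@powR R) ^~ a)) => //.
by apply/derivable1_diffP; have [] := is_derive1_powR a fx0.
Qed.

Lemma is_derive_cstf (c : R) x v : is_derive x v (fun=> c : R) 0.
Proof. exact: is_derive_cst. Qed.

Lemma is_derive_addf f g x v (df dg : R) : is_derive x v f df ->
  is_derive x v g dg -> is_derive x v (fun y => f y + g y) (df + dg).
Proof. exact: is_deriveD. Qed.

Lemma is_derive_mulf f g x v (df dg : R) : is_derive x v f df ->
  is_derive x v g dg -> is_derive x v (fun y => f y * g y) (f x * dg + g x * df).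
Proof. exact: is_deriveM. Qed.

Lemma is_derive_powRf f (a : R) x v (df : R) : 0 < f x -> differentiable f x ->
  is_derive x v f df ->
  is_derive x v (fun y => f y `^ a) (a * f x `^ (a - 1) * df).
Proof.
move=> fx0 dif dfx.
have dp : differentiable ((@powR R) ^~ a) (f x).
  by apply/derivable1_diffP; have [] := is_derive1_powR a fx0.
have dc : differentiable (((@powR R) ^~ a) \o f) x by exact: differentiable_comp.
apply: DeriveDef; first exact: diff_derivable.
rewrite (deriveE _ dc) diff_comp //= -(deriveE _ dif) derive_val.
rewrite deriv1E; last by apply/derivable1_diffP.
by rewrite powR_derive1 ?in_itv/= ?fx0// [RHS]mulrC.
Qed.

Lemma differentiable_coordf (i : 'I_n) x :
  differentiable (fun y : 'rV[R]_n => y ord0 i : R) x.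
Proof. exact: differentiable_coord. Qed.

Lemma is_derive_coordf (i : 'I_n) x v :
  is_derive x v (fun y : 'rV[R]_n => y ord0 i : R) (v ord0 i).
Proof.
apply: DeriveDef; first exact/diff_derivable/differentiable_coordf.
rewrite /derive; apply: cvg_lim => //.
apply: cvg_near_cst; near=> h.
rewrite /= !mxE addrK [_ *: _]mulrA mulVf ?mul1r //.
by near: h; exact: nbhs_dnbhs_neq.
Unshelve. all: by end_near. Qed.

Lemma differentiable_sqnorm x : differentiable (@sqnorm R n) x.
Proof.
have -> : @sqnorm R n = \sum_(i < n) (fun y : 'rV[R]_n => y ord0 i * y ord0 i).
  by rewrite funeqE => y; rewrite fct_sumE; apply: eq_bigr => i _; rewrite expr2.
by apply: differentiable_sum => i; apply: differentiable_mulf;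
  exact: differentiable_coordf.
Qed.

Lemma is_derive_sqnorm x v :
  is_derive x v (@sqnorm R n) (2 * \sum_i x ord0 i * v ord0 i).
Proof.
have -> : @sqnorm R n = \sum_(i < n) (fun y : 'rV[R]_n => y ord0 i * y ord0 i).
  by rewrite funeqE => y; rewrite fct_sumE; apply: eq_bigr => i _; rewrite expr2.
rewrite mulr_sumr; apply: is_derive_sum => i.
apply: is_derive_eq.
  exact: is_derive_mulf (is_derive_coordf i x v) (is_derive_coordf i x v).
by rewrite -mulr2n mulr_natl.
Qed.

End PointwiseDerivatives.

Lemma open_half_space (R : realType) (n : nat) : open (half_space R n).
Proof.
have -> : half_space R n = @last_coord R n @^-1` [set t | 0 < t] by [].
apply: open_comp; last exact: open_gt.
by move=> x _; exact/differentiable_continuous/differentiable_coordf.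
Qed.

(** The formulas hold on a whole open set, so [partial i f] coincides with [df i] near each of its
    points and may be differentiated again. *)
Lemma C2_near_hessian (R : realType) (n : nat) (U : set 'rV[R]_n.+1)
    (f : 'rV[R]_n.+1 -> R) (df : 'I_n.+1 -> 'rV[R]_n.+1 -> R)
    (ddf : 'I_n.+1 -> 'I_n.+1 -> 'rV[R]_n.+1 -> R) (x0 : 'rV[R]_n.+1) :
  open U -> U x0 ->
  (forall x, U x -> {for x, continuous f}) ->
  (forall x i, U x -> {for x, continuous (df i)}) ->
  (forall x i j, U x -> {for x, continuous (ddf i j)}) ->
  (forall x i, U x -> is_derive x ('e_i : 'rV[R]_n.+1) f (df i x)) ->
  (forall x i j, U x -> is_derive x ('e_j : 'rV[R]_n.+1) (df i) (ddf i j x)) ->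
  C2_near f x0 /\ hessian f x0 = \matrix_(i, j) ddf i j x0.
Proof.
move=> oU Ux0 fc dfc ddfc fd dfd.
have nearU x : U x -> \forall y \near x, U y by move=> Ux; exact: open_nbhs_nbhs.
have p1 i x : U x -> partial i f x = df i x.
  by move=> Ux; have [_ <-] := fd x i Ux.
have np1 i x : U x -> \forall y \near x, df i y = partial i f y.
  by move=> /nearU; apply: filterS => y Uy; rewrite p1.
have d2 i j x : U x -> is_derive x ('e_j : 'rV[R]_n.+1) (partial i f) (ddf i j x).
  by move=> Ux; apply: (near_eq_is_derive (np1 i x Ux)); exact: dfd.
have p2 i j x : U x -> partial j (partial i f) x = ddf i j x.
  by move=> Ux; have [_ <-] := d2 i j x Ux.
have np2 i j x : U x -> \forall y \near x, ddf i j y = partial j (partial i f) y.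
  by move=> /nearU; apply: filterS => y Uy; rewrite p2.
split; last by apply/matrixP => i j; rewrite !mxE p2.
apply: filterS (nearU _ Ux0) => x Ux; split; first exact: fc.
- move=> i; split; first by have [] := fd x i Ux.
  change (partial i f @ x --> partial i f x); rewrite p1 //.
  exact: cvg_trans (near_eq_cvg (np1 i x Ux)) (dfc x i Ux).
- move=> i j; split; first by have [] := d2 i j x Ux.
  change (partial j (partial i f) @ x --> partial j (partial i f) x); rewrite p2 //.
  exact: cvg_trans (near_eq_cvg (np2 i j x Ux)) (ddfc x i j Ux).
Qed.

Lemma sqnorm_gt0 (R : realType) (n : nat) (x : 'rV[R]_n.+1) :
  half_space R n x -> 0 < sqnorm x.
Proof.
by move=> x0; apply: lt_le_trans (last_coord_sqr_le x); rewrite exprn_gt0.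
Qed.

Section Barrier.
Context {R : realType} {n : nat}.
Implicit Types (x : 'rV[R]_n.+1) (a h A C e K g : R).

(** This is x_n^a |x|^(2h); partial derivatives stay in the family up to constants and coordinate
    factors. *)
Definition monom a h x : R := last_coord x `^ a * sqnorm x `^ h.

Lemma differentiable_monom a h x : half_space R n x ->
  differentiable (monom a h) x.
Proof.
move=> x0; apply: differentiable_mulf; apply: differentiable_powRf => //.
- exact: differentiable_coordf.
- exact: sqnorm_gt0.
- exact: differentiable_sqnorm.
Qed.

Lemma row_deltaE (i j : 'I_n.+1) : ('e_i : 'rV[R]_n.+1) ord0 j = (i == j)%:R.
Proof. by rewrite mxE eqxx eq_sym. Qed.

Lemma is_derive_monom a h x (i : 'I_n.+1) : half_space R n x ->
  is_derive x ('e_i : 'rV[R]_n.+1) (monom a h)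
    (a * (i == ord_max)%:R * monom (a - 1) h x
     + 2 * h * (x ord0 i * monom a (h - 1) x)).
Proof.
move=> x0; have S0 := sqnorm_gt0 x0.
apply: is_derive_eq.
  apply: is_derive_mulf.
    apply: is_derive_powRf => //; first exact: differentiable_coordf.
    exact: is_derive_coordf.
  apply: is_derive_powRf => //; first exact: differentiable_sqnorm.
  exact: is_derive_sqnorm.
rewrite /= row_deltaE (bigD1 i) //= row_deltaE eqxx big1 => [|j /negPf ji].
  by rewrite /monom mulr1; ring.
by rewrite row_deltaE eq_sym ji mulr0.
Qed.

(** The terms in [C] and [K] are affine and leave the Hessian unchanged, while the quadratic one
    adds [e] times the identity. *)
Definition barrier a h A C e K x : R :=
  A * monom a h x + C * last_coord x + e / 2 * sqnorm x + K.

Lemma differentiable_barrier a h A C e K x : half_space R n x ->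
  differentiable (barrier a h A C e K) x.
Proof.
move=> x0; apply: differentiable_addf; last exact: differentiable_cstf.
apply: differentiable_addf; last first.
  apply: differentiable_mulf; first exact: differentiable_cstf.
  exact: differentiable_sqnorm.
apply: differentiable_addf; apply: differentiable_mulf;
  try exact: differentiable_cstf.
- exact: differentiable_monom.
- exact: differentiable_coordf.
Qed.

Lemma barrier_C2 a h A C e K x : half_space R n x ->
  C2_near (barrier a h A C e K) x /\
  hessian (barrier a h A C e K) x = \matrix_(i, j)
    (A * (a * (i == ord_max)%:R
            * ((a - 1) * (j == ord_max)%:R * monom (a - 1 - 1) h x
               + 2 * h * (x ord0 j * monom (a - 1) (h - 1) x))
          + 2 * h * (x ord0 i
            * (a * (j == ord_max)%:R * monom (a - 1) (h - 1) x
               + 2 * (h - 1) * (x ord0 j * monom a (h - 1 - 1) x))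
            + monom a (h - 1) x * (i == j)%:R))
     + e * (i == j)%:R).
Proof.
move=> x0.
pose df i x := A * (a * (i == ord_max)%:R * monom (a - 1) h x
   + 2 * h * (x ord0 i * monom a (h - 1) x))
  + (C * (i == ord_max)%:R + e * x ord0 i).
pose ddf (i j : 'I_n.+1) x :=
    A * (a * (i == ord_max)%:R
            * ((a - 1) * (j == ord_max)%:R * monom (a - 1 - 1) h x
               + 2 * h * (x ord0 j * monom (a - 1) (h - 1) x))
          + 2 * h * (x ord0 i
            * (a * (j == ord_max)%:R * monom (a - 1) (h - 1) x
               + 2 * (h - 1) * (x ord0 j * monom a (h - 1 - 1) x))
            + monom a (h - 1) x * (i == j)%:R))
     + e * (i == j)%:R.
apply: (@C2_near_hessian _ _ _ _ df ddf x (@open_half_space R n) x0).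
- by move=> y y0; exact/differentiable_continuous/differentiable_barrier.
- move=> y i y0; apply: differentiable_continuous; rewrite /df.
  do ?[exact: differentiable_monom | exact: differentiable_cstf |
       exact: differentiable_coordf | apply: differentiable_addf |
       apply: differentiable_mulf].
- move=> y i j y0; apply: differentiable_continuous; rewrite /ddf.
  do ?[exact: differentiable_monom | exact: differentiable_cstf |
       exact: differentiable_coordf | apply: differentiable_addf |
       apply: differentiable_mulf].
- move=> y i y0; pose v := 'e_i : 'rV[R]_n.+1; pose cst c := is_derive_cstf c y v.
  apply: is_derive_eq.
    exact: is_derive_addf (is_derive_addf (is_derive_addf
      (is_derive_mulf (cst A) (is_derive_monom a h i y0))
      (is_derive_mulf (cst C) (is_derive_coordf ord_max y v)))
      (is_derive_mulf (cst (e / 2)) (is_derive_sqnorm y v))) (cst K).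
  rewrite /= row_deltaE (bigD1 i) //= row_deltaE eqxx big1 => [|j /negPf ji].
    by rewrite /df mulr1; field.
  by rewrite row_deltaE eq_sym ji mulr0.
- move=> y i j y0; pose v := 'e_j : 'rV[R]_n.+1; pose cst c := is_derive_cstf c y v.
  apply: is_derive_eq.
    exact: is_derive_addf
      (is_derive_mulf (cst A) (is_derive_addf
        (is_derive_mulf (cst _) (is_derive_monom (a - 1) h j y0))
        (is_derive_mulf (cst _) (is_derive_mulf (is_derive_coordf i y v)
          (is_derive_monom a (h - 1) j y0)))))
      (is_derive_addf (cst _) (is_derive_mulf (cst e) (is_derive_coordf i y v))).
  rewrite row_deltaE [j == i]eq_sym /ddf.
  by ring.
Qed.

Lemma monom_subl a h x : half_space R n x ->
  monom (a - 1) h x = monom a h x / last_coord x.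
Proof.
move=> x0; rewrite /monom powRB; last by apply/implyP => _; rewrite gt_eqF.
by rewrite powRr1 ?ltW // mulrAC.
Qed.

Lemma monom_subr a h x : half_space R n x ->
  monom a (h - 1) x = monom a h x / sqnorm x.
Proof.
move=> x0; have S0 := sqnorm_gt0 x0.
rewrite /monom powRB; last by apply/implyP => _; rewrite gt_eqF.
by rewrite powRr1 ?ltW // mulrA.
Qed.

Lemma hessian_barrier a g A C e K x : half_space R n x ->
  hessian (barrier a (- g / 2) A C e K) x =
    barrier_hess a g (A * monom a (- g / 2) x / sqnorm x) e x.
Proof.
move=> x0; rewrite (barrier_C2 _ _ _ _ _ _ x0).2.
apply/matrixP => i j; rewrite !mxE !monom_subl // !monom_subr //.
have S0 := lt0r_neq0 (sqnorm_gt0 x0); have t0 := lt0r_neq0 x0.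
by field; rewrite S0 t0.
Qed.

End Barrier.

(** * Comparison *)

Lemma seq_minimal (I : eqType) (d : Order.disp_t) (V : orderType d) (f : I -> V)
    (s : seq I) :
  s != [::] -> exists2 i, i \in s & forall j, j \in s -> (f i <= f j)%O.
Proof.
elim: s => // i [_ _|k s IH _]; first by exists i => [|j]; rewrite mem_seq1 // => /eqP ->.
have [//|i' i's Hi'] := IH; have [le_ii'|/ltW le_i'i] := leP (f i) (f i').
  exists i => [|j]; first by rewrite mem_head.
  by rewrite inE => /predU1P[->//|/Hi']; exact: le_trans.
exists i' => [|j]; first by rewrite inE i's orbT.
by rewrite inE => /predU1P[->//|/Hi'].
Qed.

(** Without a minimum, each y in [K] has a [z y] in [K] of smaller value, and by semicontinuity the
    sets where w exceeds [w (z y)] cover [K]. In a finite subcover, the [z i] of least value lies in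
    none of these sets. *)
Lemma compact_lsc_min (R : realType) (T : ptopologicalType) (K : set T)
    (w : T -> \bar R) :
  compact K -> K !=set0 ->
  (forall y c, K y -> (c < w y)%E -> \forall z \near y, (c < w z)%E) ->
  exists2 y, K y & forall z, K z -> (w y <= w z)%E.
Proof.
move=> cK [x0 Kx0] lsc; apply: contrapT => nomin.
have next y : exists z, K y -> K z /\ (w z < w y)%E.
  have [Ky|nKy] := pselect (K y); last by exists y.
  apply: contrapT => noz; apply: nomin; exists y => // z Kz.
  by rewrite leNgt; apply/negP => wzy; apply: noz; exists z.
have [z zP] := choice next.
pose f y := interior [set x | (w (z y) < w x)%E].
move: cK; rewrite compact_cover => /(_ T K f).
case=> [y Ky|y Ky|D DK Dcov]; first exact: open_interior.
  by exists y => //; apply: lsc => //; have [] := zP y Ky.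
have DN0 : (finmap.enum_fset D) != [::].
  apply/negP => /eqP D0; have [i] := Dcov _ Kx0.
  by rewrite /= -[_ \in _]/(i \in (finmap.enum_fset D)) D0.
have [i iD imin] := seq_minimal (fun i => w (z i)) DN0.
have Ki : K i by have := DK i iD; rewrite inE.
have [Kzi _] := zP i Ki.
have [j jD /interior_subset /= wji] := Dcov _ Kzi.
by move: (imin j jD); rewrite leNgt wji.
Qed.

(** The bound comes from x_n <= |x|. Inverted in the next lemma, it bounds the superlevel sets of q,
    which gives compactness in [comparison]; there g - b + 1 equals alpha. *)
Lemma monom_le_sqnorm (R : realType) (n : nat) (b g : R) (x : 'rV[R]_n.+1) :
  1 <= b -> half_space R n x ->
  monom (b - 1) (- g / 2) x <= sqnorm x `^ (- ((g - b + 1) / 2)).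
Proof.
move=> b1 x0; have S0 := sqnorm_gt0 x0; have t0 : 0 < last_coord x by [].
have -> : - ((g - b + 1) / 2) = (b - 1) / 2 + - g / 2 by field.
rewrite powRD; last by apply/implyP => _; rewrite gt_eqF.
rewrite /monom ler_wpM2r ?powR_ge0 //.
have -> : last_coord x `^ (b - 1) = (last_coord x ^+ 2) `^ ((b - 1) / 2).
  by rewrite -powR_mulrn ?(ltW t0) // -powRrM; congr (_ `^ _); field.
rewrite ge0_ler_powR ?nnegrE ?sqr_ge0 ?(ltW S0) ?last_coord_sqr_le //.
by rewrite divr_ge0 // subr_ge0.
Qed.

Lemma sqnorm_le_of_monom (R : realType) (n : nat) (b g z : R)
    (x : 'rV[R]_n.+1) :
  1 <= b -> b < g + 1 -> 0 < z -> half_space R n x ->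
  z <= monom (b - 1) (- g / 2) x ->
  sqnorm x <= z^-1 `^ (2 / (g - b + 1)).
Proof.
move=> b1 bg z0 x0 zle; have S0 := sqnorm_gt0 x0.
have c0 : 0 < g - b + 1 by lra.
have zS : z <= sqnorm x `^ (- ((g - b + 1) / 2)).
  exact: le_trans (monom_le_sqnorm g b1 x0).
have SE : sqnorm x = (sqnorm x `^ ((g - b + 1) / 2)) `^ (2 / (g - b + 1)).
  rewrite -powRrM; have -> : (g - b + 1) / 2 * (2 / (g - b + 1)) = 1.
    by field; rewrite gt_eqF.
  by rewrite powRr1 // ltW.
rewrite SE ge0_ler_powR ?nnegrE ?powR_ge0 ?invr_ge0 ?(ltW z0) //.
  by rewrite divr_ge0 // ltW.
by rewrite -[leLHS]invrK -powRN lef_pV2 ?posrE ?powR_gt0.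
Qed.

Lemma bounded_sqnorm (R : realType) (n : nat) (K : set 'rV[R]_n.+1) (M : R) :
  (forall x, K x -> sqnorm x <= M) -> bounded_set K.
Proof.
move=> KM; exists (1 + M); split; first exact: num_real.
move=> M' MM' x Kx; apply: le_trans (ltW MM').
rewrite [leLHS]/Num.Def.normr /= mx_normrE; apply/bigmax_leP; split => [|[i j] _ /=].
  have := KM _ Kx; have : 0 <= sqnorm x by apply: sumr_ge0 => i _; exact: sqr_ge0.
  by lra.
rewrite ord1; have : x ord0 j ^+ 2 <= M.
  apply: le_trans (KM _ Kx); rewrite /sqnorm (bigD1 j) //= lerDl.
  by apply: sumr_ge0 => k _; exact: sqr_ge0.
rewrite -real_normK ?num_real // => sqM.
have := sqr_ge0 (`|x ord0 j| - 1); rewrite sqrrB1; have := normr_ge0 (x ord0 j); nra.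
Qed.

(** Continuity of [q] is available only in the open half-space; the bound [d <= last_coord x] with d
    > 0 keeps limit points there. *)
Lemma closed_slab (R : realType) (n : nat) (d z1 z2 : R)
    (q : 'rV[R]_n.+1 -> R) :
  0 < d -> (forall x, half_space R n x -> {for x, continuous q}) ->
  closed [set x : 'rV[R]_n.+1 | [/\ d <= last_coord x, z2 <= q x & q x <= z1]].
Proof.
move=> d0 qc x xcl.
have lc : {for x, continuous (@last_coord R n)}.
  exact/differentiable_continuous/differentiable_coordf.
have dx : d <= last_coord x.
  rewrite leNgt; apply/negP => xd.
  have /xcl[y [[dy _ _] /=]] : nbhs x [set y | last_coord y < d].
    exact: lc (lt_nbhsl xd).
  by rewrite ltNge dy.
have qx : {for x, continuous q} by apply: qc; exact: lt_le_trans dx.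
split=> //; rewrite leNgt; apply/negP => qz.
  have /xcl[y [[_ zy _] /=]] : nbhs x [set y | q y < z2] by exact: qx (lt_nbhsl qz).
  by rewrite ltNge zy.
have /xcl[y [[_ _ zy] /=]] : nbhs x [set y | z1 < q y] by exact: qx (lt_nbhsr qz).
by rewrite ltNge zy.
Qed.

(** Nonnegativity of u near y serves the case c = -oo; for finite c, semicontinuity of u at level c
    + f y + d absorbs the variation of f. *)
Lemma lsc_sub_continuous (R : realType) (T : topologicalType) (u : T -> \bar R)
    (f : T -> R) (y : T) :
  (forall c : R, (c%:E < u y)%E -> \forall z \near y, (c%:E < u z)%E) ->
  (\forall z \near y, (0 <= u z)%E) -> {for y, continuous f} ->
  forall c : \bar R, (c < u y - (f y)%:E)%E ->
    \forall z \near y, (c < u z - (f z)%:E)%E.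
Proof.
move=> ulsc u0 fc [c| |_]; last first.
- apply: filterS u0 => z u0z.
  by rewrite ltNye_eq; case: (u z) u0z.
- by rewrite ltNge leey.
rewrite lteBrDr // -EFinD => cu.
have [d d0 cdu] : exists2 d, 0 < d & ((c + f y + d)%:E < u y)%E.
  case: (u y) cu => [v| |//]; last by exists 1; rewrite // ltry.
  rewrite lte_fin => cv; exists ((v - (c + f y)) / 2).
    by rewrite divr_gt0 // subr_gt0.
  by rewrite lte_fin; lra.
have fz : \forall z \near y, f z < f y + d.
  by apply: (fc [set t | t < f y + d]); apply: lt_nbhsl; rewrite ltrDl.
apply: filterS2 fz (ulsc _ cdu) => z fz uz.
rewrite lteBrDr // -EFinD; apply: lt_trans uz.
by rewrite lte_fin -addrA ltrD2l.
Qed.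

Section Comparison.
Context {R : realType} {n : nat} {lam Lam : R} {u : 'rV[R]_n.+1 -> \bar R}.
Hypotheses (n_gt0 : (0 < n)%N) (lam_gt0 : 0 < lam) (lam_le_Lam : lam <= Lam).
Hypothesis u_ge0 : forall x, half_space R n x -> (0 <= u x)%E.
Hypothesis u_lsc : forall x (c : R), half_space R n x -> (c%:E < u x)%E ->
  \forall y \near x, (c%:E < u y)%E.
Hypothesis u_super : viscosity_supersolution lam Lam u.

Let b := Lam / lam.
Let g := b * (n%:R + 2) - 1.
(* q = dfun ^ (- alpha), see dfun_powRN. *)
Let q := @monom R n (b - 1) (- g / 2).

(** The sets [q > z1] and [q > z2] are balls for [dfun], so [u1] and [u2] are the bounds that mu
    provides on two balls, and the conclusion concerns the shell between them. The contradiction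
    comes from a minimum of u - psi over a compact part [K] of that shell. *)
Lemma comparison (A B z1 z2 : R) (x0 : 'rV[R]_n.+1) :
  0 <= A -> 0 < z2 -> 0 <= A * z1 + B ->
  (forall x, half_space R n x -> z1 < q x ->
     (((A * z1 + B) * last_coord x)%:E <= u x)%E) ->
  (forall x, half_space R n x -> z2 < q x ->
     (((A * z2 + B) * last_coord x)%:E <= u x)%E) ->
  half_space R n x0 -> z2 < q x0 -> q x0 <= z1 ->
  (((A * q x0 + B) * last_coord x0)%:E <= u x0)%E.
Proof.
move=> A0 z20 a0 u1 u2 x0h z2q qz1.
have t00 : 0 < last_coord x0 by [].
have b1 : 1 <= b by rewrite /b ler_pdivlMr // mul1r.
have LE : Lam = b * lam by rewrite /b; field; rewrite gt_eqF.
have n1 : 1 <= n%:R :> R by rewrite ler1n.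
have bg : b < g + 1 by rewrite /g; nra.
pose M := z2^-1 `^ (2 / (g - b + 1)).
have M0 : 0 <= M by exact: powR_ge0.
have qM x : half_space R n x -> z2 <= q x -> sqnorm x <= M.
  by move=> xh zq; exact: sqnorm_le_of_monom.
case ux0 : (u x0) (u_ge0 x0h) => [v| |//] v0; last by rewrite leey.
(* The slack [eps] pays for two perturbations: half for the shift of q by [eta], half for the
   quadratic term. *)
rewrite lee_fin; apply/ler_addgt0Pr => eps eps0.
rewrite leNgt; apply/negP => vlt.
(* The first bound keeps x0 above level z2 + eta, the second makes A eta x_n at most eps / 2 at x0;
   adding 1 covers A = 0. *)
pose eta := Num.min ((q x0 - z2) / 2) (eps / (2 * (A * last_coord x0 + 1))).
have At0 : 0 < A * last_coord x0 + 1 by rewrite ltr_wpDl // mulr_ge0 // ltW.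
have eta0 : 0 < eta.
  by rewrite lt_min !divr_gt0 ?subr_gt0 // mulr_gt0.
have eta1 : z2 + eta < q x0.
  have : eta <= (q x0 - z2) / 2 by rewrite ge_min lexx.
  by lra.
have eta2 : A * eta * last_coord x0 <= eps / 2.
  have : eta <= eps / (2 * (A * last_coord x0 + 1)) by rewrite ge_min lexx orbT.
  rewrite ler_pdivlMr ?mulr_gt0 // => H.
  have : eta * (2 * (A * last_coord x0 + 1)) = 2 * (A * eta * last_coord x0) + 2 * eta by ring.
  by lra.
pose e := eps / (M + 1).
have e0 : 0 < e by rewrite divr_gt0 // ltr_wpDl.
have eM : e / 2 * M <= eps / 2.
  have -> : eps / 2 = e / 2 * (M + 1) by rewrite /e; field; rewrite gt_eqF // ltr_wpDl.
  by rewrite ler_wpM2l ?lerDl // divr_ge0 // ltW.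
(* eta moves the level sets of q into the open balls, where u1 and u2 apply, and
   the quadratic term makes psi a strict subsolution. *)
pose psi := @barrier R n b (- g / 2) A (B - A * eta) e (- (e / 2 * M)).
have psiE x : half_space R n x ->
    psi x = (A * (q x - eta) + B) * last_coord x + e / 2 * (sqnorm x - M).
  move=> xh; rewrite /psi /barrier /q monom_subl //.
  by field; rewrite gt_eqF.
have psi_le x : half_space R n x -> z2 <= q x ->
    psi x <= (A * (q x - eta) + B) * last_coord x.
  move=> xh zq; rewrite psiE // gerDl mulr_ge0_le0 //.
    by rewrite divr_ge0 // ltW.
  by rewrite subr_le0 qM.
have gap : v < psi x0.
  rewrite psiE //.
  have S0 : 0 <= e / 2 * sqnorm x0.
    by rewrite mulr_ge0 ?(ltW (divr_gt0 e0 _)) ?(ltW (sqnorm_gt0 x0h)).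
  have -> : (A * (q x0 - eta) + B) * last_coord x0 + e / 2 * (sqnorm x0 - M) =
    (A * q x0 + B) * last_coord x0 - A * eta * last_coord x0 +
    (e / 2 * sqnorm x0 - e / 2 * M) by ring.
  by lra.
pose a := A * z1 + B; rewrite -/a in a0.
(* Near x_n = 0 only u >= 0 is available: below height d, psi is too small to
   compete with the gap at x0. *)
pose d := Num.min (last_coord x0) ((psi x0 - v) / (a + 1)).
have a10 : 0 < a + 1 by rewrite ltr_wpDl.
have d0 : 0 < d by rewrite lt_min t00 divr_gt0 // subr_gt0.
have da : a * d < psi x0 - v.
  have : d <= (psi x0 - v) / (a + 1) by rewrite ge_min lexx orbT.
  rewrite ler_pdivlMr // mulrDr mulr1 [d * a]mulrC.
  by lra.
pose K : set 'rV[R]_n.+1 :=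
  [set x | [/\ d <= last_coord x, z2 + eta <= q x & q x <= z1 + eta]].
have Kh x : K x -> half_space R n x by case=> dx _ _; exact: lt_le_trans dx.
have qc x : half_space R n x -> {for x, continuous q}.
  by move=> xh; apply: differentiable_continuous; exact: differentiable_monom.
have psic x : half_space R n x -> {for x, continuous psi}.
  by move=> xh; apply: differentiable_continuous; exact: differentiable_barrier.
have Kq x : K x -> z2 < q x by case=> _ zq _; apply: lt_le_trans zq; rewrite ltrDl.
have cK : compact K.
  apply: bounded_closed_compact; last exact: closed_slab.
  by apply: (@bounded_sqnorm _ _ _ M) => x Kx; apply: qM; [exact: Kh|exact/ltW/Kq].
have Kx0 : K x0.
  split; [by rewrite ge_min lexx|exact: ltW|].
  by apply: le_trans qz1 _; rewrite lerDl ltW.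
have nearh x : half_space R n x -> \forall y \near x, half_space R n y.
  by move=> xh; apply: open_nbhs_nbhs; split => //; exact: open_half_space.
have [||y Ky ymin] := @compact_lsc_min R _ K (fun x => u x - (psi x)%:E)%E cK.
- by exists x0.
- move=> y c /Kh yh; apply: lsc_sub_continuous; last exact: psic.
    by move=> c'; exact: u_lsc.
  exact: filterS (@u_ge0) (nearh y yh).
have yh := Kh _ Ky.
have := ymin _ Kx0; rewrite ux0 /=.
case uy : (u y) (u_ge0 yh) => [uy'| |//] // uy0.
rewrite -!EFinB lee_fin => wy.
have wy0 : uy' < psi y by lra.
have ty0 : 0 < last_coord y by [].
have psiy := psi_le _ yh (ltW (Kq _ Ky)).
case: (Ky) => dy zqy qzy.
have dy' : d < last_coord y.
  rewrite lt_neqAle dy andbT; apply/eqP => dE.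
  have : psi y <= a * d.
    apply: le_trans psiy _; rewrite -dE ler_wpM2r ?(ltW d0) // /a lerD2r.
    by rewrite ler_wpM2l // lerBlDr.
  rewrite lee_fin in uy0; lra.
(* On q = z1 + eta the shift gives psi <= (A z1 + B) x_n, which is at most u by [u1], against u <
   psi at y. The face q = z2 + eta is treated alike with [u2]. *)
have qzy' : q y < z1 + eta.
  rewrite lt_neqAle qzy andbT; apply/eqP => qE.
  have := u1 y yh; rewrite uy lee_fin qE ltrDl => /(_ eta0).
  by move: psiy; rewrite qE addrK; lra.
have zqy' : z2 + eta < q y.
  rewrite lt_neqAle zqy andbT; apply/eqP => qE.
  have := u2 y yh; rewrite uy lee_fin -qE ltrDl => /(_ eta0).
  by move: psiy; rewrite -qE addrK; lra.
have lc : {for y, continuous (@last_coord R n)}.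
  exact/differentiable_continuous/differentiable_coordf.
have nearK : \forall x \near y, K x.
  have n1' : \forall x \near y, d < last_coord x by exact: lc (lt_nbhsr dy').
  have n2' : \forall x \near y, z2 + eta < q x by exact: qc (lt_nbhsr zqy').
  have n3' : \forall x \near y, q x < z1 + eta by exact: qc (lt_nbhsl qzy').
  by apply: filterS3 n1' n2' n3' => x h1 h2 h3; split; exact: ltW.
have : pucci_inf lam Lam (hessian psi y) <= 0.
  apply: u_super => //; first by rewrite uy ltry.
    exact: (barrier_C2 _ _ _ _ _ _ yh).1.
  by apply: filterS nearK => x Kx; exact: ymin.
rewrite leNgt => /negP; apply; rewrite hessian_barrier //.
apply: pucci_inf_barrier_hess_gt0 => //.
by rewrite divr_ge0 ?(ltW (sqnorm_gt0 yh)) // !mulr_ge0 ?powR_ge0.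
Qed.

End Comparison.

(** * The function mu *)

Lemma ltr_powRN (R : realType) (p x y : R) : 0 < p -> 0 < x -> 0 < y ->
  (y `^ (- p) < x `^ (- p)) = (x < y).
Proof.
move=> p0 x0 y0; rewrite !powRN ltf_pV2 ?posrE ?powR_gt0 //.
apply/idP/idP; last by apply: gt0_ltr_powR; rewrite // nnegrE ltW.
by apply: contraTT; rewrite -!leNgt; apply: ge0_ler_powR; rewrite ?nnegrE ltW.
Qed.

Section Mu.
Context {R : realType} {n : nat} {lam Lam : R} {u : 'rV[R]_n.+1 -> \bar R}.
Hypotheses (n_gt0 : (0 < n)%N) (lam_gt0 : 0 < lam) (lam_le_Lam : lam <= Lam).
Hypothesis u_ge0 : forall x, half_space R n x -> (0 <= u x)%E.
Hypothesis u_lsc : forall x (c : R), half_space R n x -> (c%:E < u x)%E ->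
  \forall y \near x, (c%:E < u y)%E.
Hypothesis u_super : viscosity_supersolution lam Lam u.

Let b := Lam / lam.
Let g := b * (n%:R + 2) - 1.
Let q := @monom R n (b - 1) (- g / 2).
Let al := alpha n lam Lam.
Let m := mu lam Lam u.

Lemma alpha_gt0 : 0 < al.
Proof. by rewrite /al /alpha mulr_gt0 // divr_gt0 // (lt_le_trans lam_gt0). Qed.

Lemma dfun_gt0 x : half_space R n x -> 0 < dfun lam Lam x.
Proof.
move=> xh; have S0 := sqnorm_gt0 xh; have t0 : 0 < last_coord x by [].
by rewrite /dfun mulr_gt0 ?powR_gt0 ?divr_gt0 ?sqrtr_gt0.
Qed.

(** The exponent (Lam - lam) / (Lam N) times alpha is b - 1; collecting powers gives x_n^(b-1)
    |x|^(-g). Logarithms turn this into a field identity. *)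
Lemma dfun_powRN x : half_space R n x -> dfun lam Lam x `^ (- al) = q x.
Proof.
move=> xh; have S0 := sqnorm_gt0 xh; have t0 : 0 < last_coord x by [].
have L0 : 0 < Lam by exact: lt_le_trans lam_le_Lam.
apply: ln_inj; rewrite ?posrE ?powR_gt0 ?dfun_gt0 // /q /monom.
  by rewrite mulr_gt0 ?powR_gt0.
have -> : dfun lam Lam x = (sqnorm x `^ 2^-1 / last_coord x)
    `^ ((Lam - lam) / (Lam * n.+1%:R)) * sqnorm x `^ 2^-1.
  by rewrite powR12_sqrt ?ltW.
rewrite ln_powR !lnM ?posrE ?powR_gt0 ?divr_gt0 ?powR_gt0 ?invr_gt0 //.
rewrite !ln_powR lnM ?lnV ?posrE ?powR_gt0 ?invr_gt0 // ln_powR.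
rewrite /g /b /al /alpha -natr1.
field.
by rewrite natr1 pnatr_eq0 !gt_eqF.
Qed.

Lemma dball_monom r x : 0 < r ->
  dball lam Lam r x <-> half_space R n x /\ r `^ (- al) < q x.
Proof.
move=> r0; split=> -[xh]; rewrite -dfun_powRN // ltr_powRN ?dfun_gt0 //;
  exact: alpha_gt0.
Qed.

Lemma le_mu (c r : R) : (c%:E <= m r)%E <->
  forall x, dball lam Lam r x -> ((c * last_coord x)%:E <= u x)%E.
Proof.
split=> [cm x xr|H].
  have t0 : 0 < last_coord x by case: xr.
  rewrite EFinM -lee_pdivlMr //; apply: le_trans cm _.
  by apply: ereal_inf_lbound; exists x; rewrite // inver gt_eqF.
apply: le_ereal_inf_tmp => _ [x xr <-]; have t0 : 0 < last_coord x by case: xr.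
by rewrite inver gt_eqF // lee_pdivlMr // -EFinM; exact: H.
Qed.

Lemma mu_ge0 r : (0 <= m r)%E.
Proof.
by apply/le_mu => x [xh _]; rewrite mul0r; exact: u_ge0.
Qed.

Lemma mu_antitone r s : r <= s -> (m s <= m r)%E.
Proof.
move=> rs; apply: ereal_inf_le_tmp => _ [x [xh xr] <-].
by exists x => //; split => //; exact: lt_le_trans rs.
Qed.

(** [a] and [c] are real lower bounds of mu instead of its values, so that infinite values can be
    reached through arbitrary real bounds. The condition c <= a makes the slope [A] nonnegative. *)
Lemma mu_interpolation (a c r rho Rad : R) : 0 <= c -> c <= a -> 0 < r ->
  r < Rad -> r <= rho -> rho <= Rad -> (a%:E <= m r)%E -> (c%:E <= m Rad)%E ->
  (((a * (rho `^ (- al) - Rad `^ (- al)) + c * (r `^ (- al) - rho `^ (- al)))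
   / (r `^ (- al) - Rad `^ (- al)))%:E <= m rho)%E.
Proof.
move=> c0 ca r0 rRad rrho rhoRad /le_mu ar /le_mu cRad.
have rho0 : 0 < rho by exact: lt_le_trans rrho.
have Rad0 : 0 < Rad by exact: lt_trans rRad.
have al0 := alpha_gt0.
have z21 : Rad `^ (- al) < r `^ (- al) by rewrite ltr_powRN.
have z1r : rho `^ (- al) <= r `^ (- al) by rewrite leNgt ltr_powRN // -leNgt.
have zr2 : Rad `^ (- al) <= rho `^ (- al) by rewrite leNgt ltr_powRN // -leNgt.
set z1 := r `^ (- al) in z21 z1r *; set zr := rho `^ (- al) in z1r zr2 *.
have z20 : 0 < Rad `^ (- al) by rewrite powR_gt0.
set z2 := Rad `^ (- al) in z21 zr2 z20 *.
(* The affine function t -> A t + B takes the value a at z1 and c at z2. *)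
pose A := (a - c) / (z1 - z2); pose B := c - A * z2.
have z12 : z1 - z2 != 0 by rewrite subr_eq0 gt_eqF.
have A0 : 0 <= A by rewrite divr_ge0 ?subr_ge0 // ltW.
have aE : a = A * z1 + B by rewrite /B /A; field.
have cE : c = A * z2 + B by rewrite /B; ring.
have -> : (a * (zr - z2) + c * (z1 - zr)) / (z1 - z2) = A * zr + B.
  by rewrite /B /A; field.
apply/le_mu => x /dball_monom - /(_ rho0) [xh zrq].
have t0 : 0 < last_coord x by [].
(* Where q > z1 the point lies in the r-ball and the bound by a suffices, as A zr + B <= a; the rest
   of the rho-ball lies in the shell, where [comparison] applies. *)
have [qz1|z1q] := leP (q x) z1.
  apply: (@le_trans _ _ ((A * q x + B) * last_coord x)%:E).
    by rewrite lee_fin ler_pM2r // lerD2r ler_wpM2l // ltW.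
  apply: (comparison n_gt0 lam_gt0 lam_le_Lam u_ge0 u_lsc u_super A0 z20 _ _ _ xh _ qz1).
  - by rewrite -aE; exact: le_trans ca.
  - by move=> y yh z1y; rewrite -aE; apply: ar; apply/dball_monom.
  - by move=> y yh z2y; rewrite -cE; apply: cRad; apply/dball_monom.
  - exact: le_lt_trans zrq.
apply: (@le_trans _ _ (a * last_coord x)%:E).
  by rewrite lee_fin ler_pM2r // aE lerD2r ler_wpM2l.
by apply: ar; apply/dball_monom.
Qed.

(** Interpolation between r and Rad with the trivial bound 0 at Rad, as Rad tends to infinity; this
    is the monotonicity with the powers moved across. *)
Lemma mu_tail (a c r s : R) : 0 <= a -> 0 < r -> r <= s -> (a%:E <= m r)%E ->
  m s = c%:E -> a * s `^ (- al) <= c * r `^ (- al).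
Proof.
move=> a0 r0 rs ar sc; have s0 : 0 < s by exact: lt_le_trans rs.
have c0 : 0 <= c by rewrite -lee_fin -sc mu_ge0.
have al0 := alpha_gt0.
have zs0 : 0 < s `^ (- al) by rewrite powR_gt0.
rewrite leNgt; apply/negP => gap.
(* Instead of a limit, one value z of Rad^(-alpha) is chosen: the first bound ensures Rad > s, the
   second makes a z smaller than the assumed gap. *)
pose z := Num.min (s `^ (- al) / 2)
  ((a * s `^ (- al) - c * r `^ (- al)) / (2 * (a + 1))).
have a10 : 0 < 2 * (a + 1) by rewrite mulr_gt0 // ltr_wpDl.
have z0 : 0 < z by rewrite lt_min !divr_gt0 // subr_gt0.
have zs : z < s `^ (- al).
  have : z <= s `^ (- al) / 2 by rewrite ge_min lexx.
  by lra.
have za : a * z < a * s `^ (- al) - c * r `^ (- al).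
  have : z <= (a * s `^ (- al) - c * r `^ (- al)) / (2 * (a + 1)).
    by rewrite ge_min lexx orbT.
  rewrite ler_pdivlMr // => H.
  have : z * (2 * (a + 1)) = 2 * (a * z) + 2 * z by ring.
  have : 0 <= a * z by rewrite mulr_ge0 // ltW.
  by lra.
pose Rad := z `^ (- al^-1).
have Rad0 : 0 < Rad by rewrite powR_gt0.
have RadE : Rad `^ (- al) = z.
  rewrite -powRrM; have -> : - al^-1 * - al = 1 by field; rewrite gt_eqF.
  by rewrite powRr1 // ltW.
have sRad : s < Rad by rewrite -(ltr_powRN al0) // RadE.
have rRad : r < Rad by exact: le_lt_trans sRad.
have := mu_interpolation (lexx 0) a0 r0 rRad rs (ltW sRad) ar (mu_ge0 Rad).
rewrite -/m sc lee_fin RadE mul0r addr0 ler_pdivrMr; last first.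
  by rewrite subr_gt0 -RadE ltr_powRN.
rewrite !mulrBr; have : 0 <= c * z by rewrite mulr_ge0 // ltW.
by lra.
Qed.

End Mu.

(** * Concavity and monotonicity, with infinite values of mu *)

Theorem theorem2p7 (R : realType) (n : nat) (lam Lam : R)
    (u : 'rV[R]_n.+1 -> \bar R)
    (n_ge2 : (2 <= n.+1)%N)
    (lam_gt0 : 0 < lam) (lam_le_Lam : lam <= Lam)
    (u_ge0 : forall x, closure (half_space R n) x -> (0 <= u x)%E)
    (u_lsc : lower_semicontinuous
      (u : subspace (closure (half_space R n)) -> \bar R))
    (u_super : viscosity_supersolution lam Lam u) :
  (forall r rho Rad : R, 0 < r -> r < Rad -> r <= rho -> rho <= Rad ->
     ((mu lam Lam u r
         * (rho `^ (- alpha n lam Lam) - Rad `^ (- alpha n lam Lam))%:E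
       + mu lam Lam u Rad
         * (r `^ (- alpha n lam Lam) - rho `^ (- alpha n lam Lam))%:E)
      / (r `^ (- alpha n lam Lam) - Rad `^ (- alpha n lam Lam))%:E
      <= mu lam Lam u rho)%E)
  /\
  (forall r s : R, 0 < r -> r <= s ->
     (mu lam Lam u r * (r `^ alpha n lam Lam)%:E
      <= mu lam Lam u s * (s `^ alpha n lam Lam)%:E)%E).
Proof.
have n_gt0 : (0 < n)%N by [].
have uh x : half_space R n x -> (0 <= u x)%E.
  by move=> xh; apply: u_ge0; exact: subset_closure.
have ulsc x (c : R) : half_space R n x -> (c%:E < u x)%E ->
    \forall y \near x, (c%:E < u y)%E.
  (* Semicontinuity is assumed in the subspace topology of the closed half-space; at points of the
     open half-space the neighbourhoods are the usual ones. *)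
  move=> xh /u_lsc [V nV VP]; apply: filterS VP _.
  rewrite (@nbhs_subspace_interior _ (closure (half_space R n))) //.
  apply: (@filterS _ (nbhs x) _ (half_space R n)); first exact: subset_closure.
  by apply: open_nbhs_nbhs; split => //; exact: open_half_space.
have al0 : 0 < alpha n lam Lam by exact: alpha_gt0.
have interp := mu_interpolation n_gt0 lam_gt0 lam_le_Lam uh ulsc u_super.
have tail := mu_tail n_gt0 lam_gt0 lam_le_Lam uh ulsc u_super.
have m0 := @mu_ge0 R n lam Lam u uh.
set al := alpha n lam Lam in al0 interp tail *; split; last first.
  move=> r s r0 rs; have s0 : 0 < s by exact: lt_le_trans rs.
  have rp : 0 < r `^ al by rewrite powR_gt0.
  have sp : 0 < s `^ al by rewrite powR_gt0.
  case ms : (mu lam Lam u s) (m0 s) => [c| |//] c0; last first.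
    by rewrite gt0_mulye ?lte_fin // leey.
  have key a : 0 <= a -> (a%:E <= mu lam Lam u r)%E -> a * r `^ al <= c * s `^ al.
    move=> a0 ar; have := tail _ _ _ _ a0 r0 rs ar ms.
    rewrite !powRN ler_pdivlMr // mulrAC ler_pdivrMr //.
  case mr : (mu lam Lam u r) (m0 r) => [a| |//] a0.
    by rewrite -!EFinM lee_fin; apply: key; rewrite ?mr.
  (* If mu(r) is infinite, [key] applies to every real a >= 0; this one would give c s^alpha + 1 <=
     c s^alpha. *)
  have C0 : 0 <= (c * s `^ al + 1) / r `^ al.
    by rewrite divr_ge0 ?(ltW rp) // addr_ge0 // mulr_ge0 // ltW.
  have := key _ C0; rewrite mr leey => /(_ isT).
  by rewrite divfK ?gt_eqF // => H; have : False by lra.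
move=> r rho Rad r0 rRad rrho rhoRad.
have rho0 : 0 < rho by exact: lt_le_trans rrho.
have Rad0 : 0 < Rad by exact: lt_trans rRad.
have z12 : 0 < r `^ (- al) - Rad `^ (- al) by rewrite subr_gt0 ltr_powRN.
have anti : (mu lam Lam u Rad <= mu lam Lam u r)%E by apply: mu_antitone; exact: ltW.
have antirho : (mu lam Lam u Rad <= mu lam Lam u rho)%E by exact: mu_antitone.
case mRad : (mu lam Lam u Rad) (m0 Rad) => [c| |//] c0; last first.
  by move: antirho; rewrite mRad leye_eq => /eqP ->; rewrite leey.
case mr : (mu lam Lam u r) (m0 r) => [a| |//] a0.
  rewrite -!EFinM -EFinD inver gt_eqF // -EFinM; apply: interp => //.
  - by rewrite -lee_fin -mRad -mr.
  - by rewrite mr.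
  - by rewrite mRad.
(* Here mu(r) is infinite. For rho = Rad its weight vanishes, and 0 times infinity is 0, which
   leaves mu(Rad). *)
have [rhoE|rho_lt] := eqVneq rho Rad.
  rewrite rhoE subrr mule0 add0e -EFinM inver gt_eqF // -EFinM.
  by rewrite mulfK ?gt_eqF // mRad.
have {}rho_lt : rho < Rad by rewrite lt_neqAle rho_lt.
have zr2 : 0 < rho `^ (- al) - Rad `^ (- al) by rewrite subr_gt0 ltr_powRN.
case mrho : (mu lam Lam u rho) (m0 rho) => [v| |//] v0; last by rewrite leey.
(* Chosen so that interpolation with the lower bound 0 at Rad gives mu(rho) >= v + 1, contradicting
   mu(rho) = v. *)
pose a := (v + 1) * (r `^ (- al) - Rad `^ (- al)) / (rho `^ (- al) - Rad `^ (- al)).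
have a0' : 0 <= a.
  by rewrite divr_ge0 ?(ltW zr2) // mulr_ge0 ?(ltW z12) // addr_ge0.
have := interp a 0 r rho Rad (lexx 0) a0' r0 rRad rrho rhoRad.
rewrite mr mRad mrho leey => /(_ isT c0).
rewrite mul0r addr0 divfK ?gt_eqF // mulfK ?gt_eqF // lee_fin.
by move=> H; have : False by lra.
Qed.
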